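(* Let $m,n\ge1$ be integers, not both equal to $1$. The multigraph $T_{m\times n}$ supports a tour that realizes a longitude if and only if $m$ is odd or $n$ is even.
   Context: A knight pair is an ordered pair of integers $(x,y)$ with $\{|x|,|y|\}=\{1,2\}$. For positive integers $m,n$, the multigraph (possibly with loops) $T_{m\times n}$ has vertex set $\{(a,b)\in\mathbb{Z}^2 : 0\le a\le m-1,\ 0\le b\le n-1\}$. A toroidal jump is a knight pair $(x,y)$ together with a vertex $(a,b)$; it joins $(a,b)$ to $((a+x)\bmod m,(b+y)\bmod n)$. The jumps $(x,y),(a,b)$ and $(-x,-y),((a+x)\bmod m,(b+y)\bmod n)$ are declared equivalent, and $T_{m\times n}$ has exactly one edge for each equivalence class. Let $T=\mathbb{R}^2/(m\mathbb{Z}\times n\mathbb{Z})$ with base point $t_0=(1/2,1/2)$. Define $j_t$ sending vertex $(a,b)$ to $(a+1/2,b+1/2)$ and the edge given by the jump $(x,y),(a,b)$ to the path $s\mapsto (a+1/2+xs,\,b+1/2+ys)$ mod $(m\mathbb{Z}\times n\mathbb{Z})$, $s\in[0,1]$. A tour on $T_{m\times n}$ is a Hamiltonian cycle based at $(0,0)$: if $mn=1$ it is the constant loop; otherwise a cyclic sequence $(0,0)=v_0,\dots,v_{mn-1}$ listing every vertex exactly once, with pairwise distinct edges $e_0,\dots,e_{mn-1}$, $e_i$ joining $v_i$ and $v_{i+1}$ (indices mod $mn$). Traversing $j_t(e_0),\dots,j_t(e_{mn-1})$ in order gives a loop in $T$ based at $t_0$. The tour realizes a longitude if this loop is homotopic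 (rel basepoint) to the longitude $\lambda(s)=(1/2,1/2+ns)$ mod $(m\mathbb{Z}\times n\mathbb{Z})$, $s\in[0,1]$, or to its reverse. $T_{m\times n}$ supports such a tour if some tour on it realizes a longitude. *)

(* Defs.v *)
From HB Require Import structures.
From mathcomp Require Import all_boot all_order all_algebra.
From mathcomp Require Import generic_quotient.
From mathcomp Require Import all_classical all_reals all_analysis.

Set Implicit Arguments.
Unset Strict Implicit.
Unset Printing Implicit Defensive.

Import Order.TTheory GRing.Theory Num.Theory.
Import numFieldNormedType.Exports.

Local Open Scope classical_set_scope.
Local Open Scope quotient_scope.
Local Open Scope ring_scope.

Definition knightb (d : int * int) : bool :=
  perm_eq [:: `|d.1|%N; `|d.2|%N] [:: 1%N; 2%N].

Definition knight : Type := {d : int * int | knightb d}.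
HB.instance Definition _ := Choice.on knight.

Lemma knightbN (d : int * int) : knightb d -> knightb (- d.1, - d.2).
Proof. by rewrite /knightb /= !abszN. Qed.

Definition knight_opp (d : knight) : knight :=
  exist knightb (- (val d).1, - (val d).2) (knightbN (valP d)).

Lemma knight_oppK : involutive knight_opp.
Proof. by move=> [[x y] h]; apply/val_inj; rewrite /= !opprK. Qed.

Lemma ord_shift_subproof (m : nat) (a : 'I_m) (x : int) :
  (`|((a%:Z + x) %% m%:Z)%Z| < m)%N.
Proof.
have m0 : m%:Z != 0 by case: m a => [[]|].
have := ltz_mod (a%:Z + x) m0.
by rewrite -ltz_nat gez0_abs ?modz_ge0 // ger0_norm.
Qed.

(* (a + x) mod m *)
Definition ord_shift (m : nat) (a : 'I_m) (x : int) : 'I_m :=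
  Ordinal (ord_shift_subproof a x).

Lemma ord_shiftK (m : nat) (a : 'I_m) (x : int) :
  ord_shift (ord_shift a x) (- x) = a.
Proof.
have m0 : m%:Z != 0 by case: m a => [[]|].
apply/val_inj => /=; rewrite gez0_abs ?modz_ge0 // modzDml addrK.
by rewrite modz_small //= ltz_nat ltn_ord.
Qed.

Definition vertex (m n : nat) : Type := ('I_m * 'I_n)%type.
HB.instance Definition _ m n := Finite.on (vertex m n).

Definition jump (m n : nat) : Type := (knight * vertex m n)%type.
HB.instance Definition _ m n := Choice.on (jump m n).

Section multigraph.
Context {m n : nat}.
Implicit Types (J K : jump m n) (u w : vertex m n).

Definition jump_tail J : vertex m n := J.2.

Definition jump_head J : vertex m n :=
  (ord_shift J.2.1 (val J.1).1, ord_shift J.2.2 (val J.1).2).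

Definition jump_rev J : jump m n := (knight_opp J.1, jump_head J).

Lemma jump_revK : involutive jump_rev.
Proof.
move=> [d [a b]]; rewrite /jump_rev /jump_head /=.
by rewrite knight_oppK !ord_shiftK.
Qed.

Definition jump_rel J K : bool := (J == K) || (jump_rev J == K).

Lemma jump_rel_refl : reflexive jump_rel.
Proof. by move=> J; rewrite /jump_rel eqxx. Qed.

Lemma jump_rel_sym : symmetric jump_rel.
Proof.
by move=> J K; rewrite /jump_rel eq_sym (inv_eq jump_revK) (eq_sym J).
Qed.

Lemma jump_rel_trans : transitive jump_rel.
Proof.
move=> K J L; rewrite /jump_rel.
case/orP=> /eqP <- /orP[] /eqP <-; rewrite ?jump_revK ?eqxx ?orbT //.
Qed.

Definition jump_equiv := EquivRel _ jump_rel_refl jump_rel_sym jump_rel_trans.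

End multigraph.

(* The edges of T_{m x n}: one for each equivalence class of jumps. *)
Definition edge (m n : nat) : Type := {eq_quot (@jump_equiv m n)}.
HB.instance Definition _ m n := Choice.on (edge m n).
HB.instance Definition _ m n := Quotient.on (edge m n).

Section tours.
Context {m n : nat}.

(* Symmetric in u and w, by jump_rev. *)
Definition joins (e : edge m n) (u w : vertex m n) : Prop :=
  exists J : jump m n,
    [/\ \pi_(edge m n) J = e, jump_tail J = u & jump_head J = w].

(* The representative of e that starts at u, where e is incident with u;
   it is unique unless e is a loop. *)
Definition orient (u : vertex m n) (e : edge m n) : jump m n :=
  let J : jump m n := repr e in if jump_tail J == u then J else jump_rev J.

(* For m * n = 1 the tour is the constant loop and e plays no role. *)
Definition is_tour (v : 'I_(m * n) -> vertex m n)
    (e : 'I_(m * n) -> edge m n) : Prop :=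
  [/\ bijective v,
      forall i : 'I_(m * n), i = 0%N :> nat ->
        (v i).1 = 0%N :> nat /\ (v i).2 = 0%N :> nat
    & (m * n)%N <> 1%N ->
        injective e /\ forall i, joins (e i) (v i) (v (ordS i))].

End tours.

Section torus.
Context (R : realType) (m n : nat).

Definition torus_rel (p q : R * R) : bool :=
  `[< exists k l : int, q.1 = p.1 + k%:~R * m%:R /\ q.2 = p.2 + l%:~R * n%:R >].

Lemma torus_rel_refl : reflexive torus_rel.
Proof. by move=> p; apply/asboolP; exists 0, 0; rewrite !mul0r !addr0. Qed.

Lemma torus_rel_sym : symmetric torus_rel.
Proof.
suff H p q : torus_rel p q -> torus_rel q p.
  by move=> p q; apply/idP/idP; apply: H.
move=> /asboolP[k [l [h1 h2]]]; apply/asboolP; exists (- k), (- l).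
by rewrite h1 h2 !mulrNz !mulNr !addrK.
Qed.

Lemma torus_rel_trans : transitive torus_rel.
Proof.
move=> q p r /asboolP[k [l [h1 h2]]] /asboolP[k' [l' [h1' h2']]].
apply/asboolP; exists (k + k'), (l + l').
by rewrite h1' h2' h1 h2 !intrD !mulrDl !addrA.
Qed.

Definition torus_equiv :=
  EquivRel _ torus_rel_refl torus_rel_sym torus_rel_trans.

(* R^2 / (m Z x n Z), with the quotient topology. *)
Definition torus : Type := {eq_quot torus_equiv}.
HB.instance Definition _ := Topological.copy torus (quotient_topology torus).
HB.instance Definition _ := Quotient.on torus.

End torus.

(* Paths are functions on R of which only the values on [0, 1] matter. *)
Section paths.
Context {R : realType} {T : topologicalType}.

Definition path_concat (f g : R -> T) (s : R) : T :=
  if s <= 2^-1 then f (2 * s) else g (2 * s - 1).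

(* The paths of ps one after the other, followed by the constant path at x;
   other parametrizations are homotopic to this one rel endpoints. *)
Definition traverse (x : T) (ps : seq (R -> T)) : R -> T :=
  foldr path_concat (cst x) ps.

Definition path_reverse (f : R -> T) (s : R) : T := f (1 - s).

Definition loop_homotopic (x : T) (f g : R -> T) : Prop :=
  exists H : R * R -> T,
    [/\ {within `[0, 1] `*` `[0, 1], continuous H},
        forall s : R, s \in `[0, 1] -> H (s, 0) = f s,
        forall s : R, s \in `[0, 1] -> H (s, 1) = g s
      & forall t : R, t \in `[0, 1] -> H (0, t) = x /\ H (1, t) = x].

End paths.

Section realization.
Context (R : realType) {m n : nat}.
Local Notation T := (torus R m n).

Definition torus_pt (x y : R) : T := \pi_T (x, y).

Definition torus_base : T := torus_pt 2^-1 2^-1.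

(* j_t on an edge, parametrized from the tail of the given representative;
   jump_path (jump_rev J) is the reverse of jump_path J. *)
Definition jump_path (J : jump m n) (s : R) : T :=
  torus_pt (J.2.1%:R + 2^-1 + (val J.1).1%:~R * s)
           (J.2.2%:R + 2^-1 + (val J.1).2%:~R * s).

Definition tour_loop (v : 'I_(m * n) -> vertex m n)
    (e : 'I_(m * n) -> edge m n) : R -> T :=
  if (m * n == 1)%N then cst torus_base
  else traverse torus_base
         [seq jump_path (orient (v i) (e i)) | i <- enum 'I_(m * n)].

Definition longitude (s : R) : T := torus_pt 2^-1 (2^-1 + n%:R * s).

Definition realizes_longitude (v : 'I_(m * n) -> vertex m n)
    (e : 'I_(m * n) -> edge m n) : Prop :=
  loop_homotopic torus_base (tour_loop v e) longitude \/
  loop_homotopic torus_base (tour_loop v e) (path_reverse longitude).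

End realization.

Definition supports_longitude_tour (R : realType) (m n : nat) : Prop :=
  exists (v : 'I_(m * n) -> vertex m n) (e : 'I_(m * n) -> edge m n),
    is_tour v e /\ realizes_longitude R v e.

(* Main.v *)
(* A homotopy of loops in the torus does not move the endpoint of a lift to the
   plane, so a tour realizes a longitude exactly when its knight steps add up to
   (0, n) or (0, -n); the converse is a straight-line homotopy between lifts.
   Each of the m n knight steps has odd coordinate sum, hence n = m n mod 2, that
   is, m is odd or n is even.  Conversely, if a walk tours T_{m x c} with total
   displacement (0, c), then repeating it d times tours T_{m x cd} with total
   displacement (0, cd).  So it suffices to tour T_{m x 2} for all m, T_{m x 1}
   for odd m > 1, and T_{1 x n} for odd n > 1. *)
Require Import Defs.
From HB Require Import structures.
From mathcomp Require Import all_boot all_order all_algebra.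
From mathcomp Require Import generic_quotient zify ring lra.
From mathcomp Require Import all_classical all_reals all_analysis.

Set Implicit Arguments.
Unset Strict Implicit.
Unset Printing Implicit Defensive.

Import Order.TTheory GRing.Theory Num.Theory.
Import numFieldNormedType.Exports.

Local Open Scope classical_set_scope.
Local Open Scope quotient_scope.
Local Open Scope ring_scope.

(** * Lifting paths and homotopies *)

Section lattice.
Context (R : realType) (m n : nat).
Local Notation T := (torus R m n).
Implicit Types p q : R * R.

Lemma torus_piP p q : \pi_T p = \pi_T q <->
  exists d : int * int, q - p = (d.1%:~R * m%:R, d.2%:~R * n%:R).
Proof.
split.
  move=> /eqmodP /asboolP[k [l [h1 h2]]]; exists (k, l) => /=.
  rewrite [q]surjective_pairing [p]surjective_pairing; congr pair.
    by rewrite /= h1 addrAC subrr add0r.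
  by rewrite /= h2 addrAC subrr add0r.
move=> [d /esym[h1 h2]]; apply/eqmodP/asboolP; exists d.1, d.2.
by rewrite h1 h2 !addrA !(addrAC _ _ (- _)) !subrr !add0r.
Qed.

(** Two lifts of one point differ by a lattice vector, and a nonzero one has sup norm at least 1. *)
Lemma torus_pi_inj p q : (0 < m)%N -> (0 < n)%N -> `|q - p| < 1 ->
  \pi_T p = \pi_T q -> p = q.
Proof.
move=> m0 n0 + /torus_piP[d dE]; rewrite dE.
have small (k : int) (l : nat) : (0 < l)%N -> `|k%:~R * l%:R : R| < 1 -> k = 0.
  move=> l0; rewrite -[l%:R]/(l%:Z%:~R) -intrM -intr_norm -[1]/(1%:~R) ltr_int.
  by nia.
rewrite prod_normE gt_max /= => /andP[/(small _ _ m0) d1 /(small _ _ n0) d2].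
by apply/esym/eqP; rewrite -subr_eq0 dE d1 d2 !mul0r.
Qed.

Lemma torus_pi_continuous : continuous (\pi_T : R * R -> T).
Proof. exact: pi_continuous. Qed.

(** The projection is open: the set above the image of a ball is a union of translates of that
    ball. *)
Lemma torus_pi_near p (e : R) : 0 < e ->
  \forall z \near \pi_T p, exists2 q, \pi_T q = z & `|q - p| < e.
Proof.
move=> e0; pose A := [set z : T | exists2 q, \pi_T q = z & `|q - p| < e].
suff oA : open A.
  by apply: (open_nbhs_nbhs (A := A)); split=> //; exists p; rewrite ?subrr ?normr0.
rewrite /open/= /quotient_open openE => r [q qr qp].
apply/nbhs_ballP; exists (e - `|q - p|); first by rewrite /= subr_gt0.
move=> r'; rewrite -ball_normE /= => rr'.
exists (q + (r' - r)); last first.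
  by rewrite addrAC (le_lt_trans (ler_normD _ _)) // -ltrBrDl distrC.
apply/esym/torus_piP; have /torus_piP[d dE] := esym qr; exists d.
by rewrite -dE addrCA addrAC subrr add0r.
Qed.

End lattice.

(** Connectedness of [0, 1]: a locally constant [P] holds on a set that is both open and closed in
    the segment, through the interiors of [U true] and [U false]. *)
Lemma unit_segment_ind (R : realType) (P : R -> Prop) :
  (forall s : R, s \in `[0, 1] ->
     \forall s' \near s, s' \in `[0, 1] -> P s <-> P s') ->
  P 0 -> P 1.
Proof.
move=> loc P0; have I1 : (1 : R) \in `[0, 1] by rewrite in_itv /= ler01 lexx.
have I0 : (0 : R) \in `[0, 1] by rewrite in_itv /= ler01 lexx.
suff: [set s | s \in `[0, 1] /\ P s] = `[0, 1]%classic.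
  by move=> E; have: `[0, 1]%classic (1 : R) by []; rewrite -E => -[].
pose U (b : bool) := [set s : R | s \in `[0, 1] -> P s <-> b].
have memU (b : bool) s : s \in `[0, 1] -> (P s <-> b) -> (U b)^° s.
  move=> sI Psb; rewrite /interior; near=> s' => s'I; rewrite -Psb; apply: iff_sym.
  by move: (s'I); near: s'; exact: loc.
apply: (segment_connected (a := 0) (b := 1)).
- by exists 0.
- exists ((U true)^°); first exact: open_interior.
  rewrite eqEsubset; split=> [s [sI Ps]|s [sI /interior_subset /(_ sI)[_]]].
    by split=> //; apply: memU.
  by move/(_ isT).
- exists (~` (U false)^°); first exact/open_closedC/open_interior.
  rewrite eqEsubset; split=> [s [sI Ps]|s [sI Us]].
    by split=> // /interior_subset /(_ sI) [/(_ Ps)].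
  split=> //; apply: contrapT => nPs; apply: Us; apply: memU => //.
Unshelve. all: by end_near. Qed.

Section lifts.
Context (R : realType) (m n : nat).
Hypotheses (m0 : (0 < m)%N) (n0 : (0 < n)%N).
Local Notation T := (torus R m n).
Implicit Types (p q : R * R) (f g : R -> T) (L : R -> R * R).

Definition lifts L f :=
  {within `[0, 1], continuous L} /\ forall s, s \in `[0, 1] -> \pi_T (L s) = f s.

Lemma within_unit_near L (s e : R) : {within `[0, 1], continuous L} ->
  s \in `[0, 1] -> 0 < e ->
  \forall s' \near s, s' \in `[0, 1] -> `|L s' - L s| < e.
Proof.
move=> /subspace_continuousP cL sI e0.
have /cvgrPdist_lt/(_ e e0) := cL s sI.
rewrite near_withinE; apply: filterS => s' h s'I; rewrite distrC; exact: h.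
Qed.

(** Uniqueness of lifts. Near s both lifts move by less than 1/2, so if they agree at one of s, s'
    they are less than 1 apart at the other, where [torus_pi_inj] identifies them. *)
Lemma lifts_endpoint L L' f : lifts L f -> lifts L' f ->
  L 0 = L' 0 -> L 1 = L' 1.
Proof.
move=> [cL Lf] [cL' Lf'].
apply: (unit_segment_ind (P := fun s => L s = L' s)) => s sI.
have h : 0 < 2^-1 :> R by rewrite invr_gt0 ltr0n.
near=> s' => s'I.
have d1 : `|L s' - L s| < 2^-1 by apply: (near (within_unit_near cL sI h)).
have d2 : `|L' s' - L' s| < 2^-1 by apply: (near (within_unit_near cL' sI h)).
have d : `|(L' s' - L' s) - (L s' - L s)| < 1.
  by rewrite (le_lt_trans (ler_normB _ _)) //; lra.
split=> E.
  apply: (torus_pi_inj m0 n0); last by rewrite Lf ?Lf'.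
  by move: d; rewrite E opprB addrA subrK.
apply: (torus_pi_inj m0 n0); last by rewrite Lf ?Lf'.
by move: d; rewrite E opprB addrC addrA subrK distrC.
Unshelve. all: by end_near. Qed.

(** Distance below 1/4 in the torus; the bound lets four such displacements add up to less than
    1. *)
Definition near_pts (z w : T) :=
  exists p q, [/\ \pi_T p = z, \pi_T q = w & `|q - p| < 4^-1].

Lemma near_pts_sym z w : near_pts z w -> near_pts w z.
Proof. by move=> [p [q [pz qw pq]]]; exists q, p; rewrite distrC. Qed.

Lemma near_pts_lift p w : near_pts (\pi_T p) w ->
  exists2 q, \pi_T q = w & `|q - p| < 4^-1.
Proof.
(* The given pair may lie over another sheet, so it is translated by the lattice vector p - p'. *)
move=> [p' [q' [/torus_piP[d dE] <- pq]]]; exists (q' + (p - p')).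
  by apply/esym/torus_piP; exists d; rewrite -dE addrAC subrr add0r.
by rewrite addrCA addrAC subrr add0r.
Qed.

(** Above each g s a point within 1/4 of L s is chosen. Closeness to L forces these choices to fit
    together continuously, and to return L s wherever f s = g s. *)
Lemma lifts_near L f g : lifts L f -> {within `[0, 1], continuous g} ->
  (forall s, s \in `[0, 1] -> near_pts (f s) (g s)) -> f 0 = g 0 -> f 1 = g 1 ->
  exists L', [/\ lifts L' g, L' 0 = L 0 & L' 1 = L 1].
Proof.
move=> [cL Lf] /subspace_continuousP cg fg fg0 fg1.
have I1 : (1 : R) \in `[0, 1] by rewrite in_itv /= ler01 lexx.
have I0 : (0 : R) \in `[0, 1] by rewrite in_itv /= ler01 lexx.
have {fg} : forall s, exists q, s \in `[0, 1] -> \pi_T q = g s /\ `|q - L s| < 4^-1.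
  move=> s; have [sI|] := boolP (s \in `[0, 1]); last by exists 0.
  by have := fg s sI; rewrite -Lf // => /near_pts_lift[q]; exists q.
move=> /choice[L' L'E].
have end_eq s : s \in `[0, 1] -> f s = g s -> L' s = L s.
  move=> sI fgs; have [Lg dL] := L'E s sI.
  apply/esym/(torus_pi_inj m0 n0); last by rewrite Lf // Lg.
  by rewrite (lt_trans dL) //; lra.
exists L'; split; [split; last by move=> s /L'E[] | exact: end_eq | exact: end_eq].
apply/subspace_continuousP => s sI.
have q4 : 0 < 4^-1 :> R by rewrite invr_gt0 ltr0n.
apply/cvgrPdist_lt => e e0; rewrite near_withinE.
have e'0 : 0 < Num.min e 4^-1 by rewrite lt_min e0.
have [Lg dL] := L'E s sI.
have near_g := torus_pi_near m n (L' s) e'0.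
have near_g' : \forall s' \near s, s' \in `[0, 1] ->
    exists2 q, \pi_T q = g s' & `|q - L' s| < Num.min e 4^-1.
  by rewrite Lg in near_g; exact: cg sI _ near_g.
near=> s' => s'I.
have [q qg] : exists2 q, \pi_T q = g s' & `|q - L' s| < Num.min e 4^-1.
  by move: (s'I); apply: (near near_g').
rewrite lt_min => /andP[qe q4'].
have [L'g dL'] := L'E s' s'I.
have dLL : `|L s' - L s| < 4^-1 by apply: (near (within_unit_near cL sI q4)).
suff L'q : L' s' = q by rewrite /from_subspace L'q distrC.
apply: (torus_pi_inj m0 n0); last by rewrite L'g.
(* Each of the four differences has norm below 1/4, so q and L' s', which project to the same point,
   are less than 1 apart. *)
have -> : q - L' s' = ((q - L' s) + (L' s - L s)) - ((L' s' - L s') + (L s' - L s)).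
  by rewrite !addrA !subrK opprB addrA subrK.
rewrite (le_lt_trans (ler_normB _ _)) //.
have := ler_normD (q - L' s) (L' s - L s).
have := ler_normD (L' s' - L s') (L s' - L s).
by lra.
Unshelve. all: by end_near. Qed.

(** Compactness of [0, 1] makes the continuity of [H] in t uniform in s. *)
Lemma homotopy_near (H : R * R -> T) (t : R) :
  {within `[0, 1] `*` `[0, 1], continuous H} -> t \in `[0, 1] ->
  \forall t' \near t, t' \in `[0, 1] -> forall s, s \in `[0, 1] ->
    near_pts (H (s, t)) (H (s, t')).
Proof.
move=> /subspace_continuousP cH tI.
(* Two points within 1/8 of a common lift are within 1/4 of each other, as [near_pts] asks. *)
have e0 : 0 < 8^-1 :> R by rewrite invr_gt0 ltr0n.
have := @segment_compact R 0 1 => /compact_near_coveringP.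
move=> /(_ _ (nbhs t) (fun t' s => t' \in `[0, 1] -> s \in `[0, 1] ->
   near_pts (H (s, t)) (H (s, t')))) cpt.
apply: filterS (cpt _ _) => [t' h t'I s sI|s sI]; first exact: h.
have := torus_pi_near m n (repr (H (s, t))) e0; rewrite reprK.
move/(cH (s, t) (conj sI tI)) => hn.
case: hn => -[A B] /= [As Bt] hn.
exists (A, B) => // -[s' t'] /= [As' Bt'] t'I s'I.
have [p pE dp] := hn (s', t) (conj As' (nbhs_singleton Bt)) (conj s'I tI).
have [q qE dq] := hn (s', t') (conj As' Bt') (conj s'I t'I).
exists p, q; split=> //.
have -> : q - p = (q - repr (H (s, t))) - (p - repr (H (s, t))).
  by rewrite opprB addrA subrK.
by rewrite (le_lt_trans (ler_normB _ _)) //; lra.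
Qed.

Lemma homotopy_section (H : R * R -> T) (t : R) :
  {within `[0, 1] `*` `[0, 1], continuous H} -> t \in `[0, 1] ->
  {within `[0, 1], continuous (fun s => H (s, t))}.
Proof.
move=> /subspace_continuousP cH tI; apply/subspace_continuousP => s sI.
apply: cvg_trans (cH (s, t) (conj sI tI)) => A hA.
case: hA => -[B C] /= [Bs Ct] hA.
rewrite /nbhs /= /within; apply: filterS Bs => s' Bs' s'I.
exact: (hA (s', t) (conj Bs' (nbhs_singleton Ct)) (conj s'I tI)).
Qed.

(** Instead of lifting [H] on the whole square, its rows are lifted one at a time. By [lifts_near],
    having a lift with the endpoints of L is locally constant in t; at t = 1 uniqueness compares
    that lift with L'. *)
Lemma loop_homotopic_lifts x f g L L' : lifts L f -> lifts L' g ->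
  loop_homotopic x f g -> L 0 = L' 0 -> L 1 = L' 1.
Proof.
move=> Lf L'g [H [cH H0 H1 Hx]] LL'0.
have I1 : (1 : R) \in `[0, 1] by rewrite in_itv /= ler01 lexx.
have I0 : (0 : R) \in `[0, 1] by rewrite in_itv /= ler01 lexx.
pose P t := exists M, [/\ lifts M (fun s => H (s, t)), M 0 = L 0 & M 1 = L 1].
have [M [[cM MH] M0 M1]] : P 1.
  apply: unit_segment_ind => [t tI|]; last first.
    by exists L; split=> //; case: Lf => cL Lf; split=> // s sI; rewrite Lf ?H0.
  have step t1 t2 : t1 \in `[0, 1] -> t2 \in `[0, 1] ->
      (forall s, s \in `[0, 1] -> near_pts (H (s, t1)) (H (s, t2))) ->
      P t1 -> P t2.
    move=> t1I t2I near12 [M [MH M0 M1]].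
    have [||M' [M'H M'0 M'1]] := lifts_near MH (homotopy_section cH t2I) near12.
    - by rewrite (Hx _ t1I).1 (Hx _ t2I).1.
    - by rewrite (Hx _ t1I).2 (Hx _ t2I).2.
    - by exists M'; rewrite M'0 M'1.
  apply: filterS (homotopy_near cH tI) => t' near_tt' t'I.
  split; apply: step => // s sI; first exact: near_tt'.
  exact/near_pts_sym/near_tt'.
rewrite -M1; apply: (lifts_endpoint _ L'g); last by rewrite M0.
by split=> // s sI; rewrite MH ?H1.
Qed.

Lemma straight_line_homotopic x f g L L' : lifts L f -> lifts L' g ->
  \pi_T (L 0) = x -> \pi_T (L 1) = x -> L 0 = L' 0 -> L 1 = L' 1 -> loop_homotopic x f g.
Proof.
move=> [cL Lf] [cL' L'g] L0 L1 LL0 LL1.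
exists (fun st => \pi_T (L st.1 + st.2 *: (L' st.1 - L st.1))); split.
- apply/subspace_continuousP => -[s t] [/= sI tI].
  apply: (@cvg_comp _ _ _ (fun st : R * R => L st.1 + st.2 *: (L' st.1 - L st.1))
            (\pi_T : R * R -> T)); last exact: torus_pi_continuous.
  have cvg1 (M : R -> R * R) : {within `[0, 1], continuous M} ->
    M st.1 @[st --> within (`[0, 1] `*` `[0, 1]) (nbhs (s, t))] --> (M s : R * R).
    move=> /subspace_continuousP /(_ s sI) cM; apply: cvg_comp cM => A.
    move=> hA; exists (fun s' => s' \in `[0, 1] -> A s', setT) => /=.
      by split=> //; exact: filterT.
    by move=> -[s' t'] /= [h _] [/h].
  apply: cvgD; first exact: cvg1.
  apply: cvgZ; last by apply: cvgB; exact: cvg1.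
  by apply: cvg_within_filter; exact: cvg_snd.
- by move=> s sI /=; rewrite scale0r addr0 Lf.
- by move=> s sI /=; rewrite scale1r addrC subrK L'g.
- by move=> t tI /=; rewrite -LL0 -LL1 !subrr scaler0 !addr0.
Qed.
End lifts.

(** * Walks with total displacement (0, n) *)

(** Positions are kept in the plane, unreduced, so that the total displacement remains visible. The
    last clause is injectivity modulo m and n; by counting, every vertex is then visited. *)
Definition longitude_walk (m n : nat) (P : nat -> int * int) : Prop :=
  [/\ P 0%N = (0, 0), P (m * n)%N = (0, n%:Z),
      forall i, (i < m * n)%N -> knightb (P i.+1 - P i)
    & forall i j (a b : int), (i < m * n)%N -> (j < m * n)%N ->
        (P i).1 = (P j).1 + a * m%:Z -> (P i).2 = (P j).2 + b * n%:Z -> i = j].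

Lemma eq_of_congr (m : nat) (x y a : int) : 0 <= x < m%:Z -> 0 <= y < m%:Z ->
  x = y + a * m%:Z -> x = y.
Proof.
move=> /andP[x0 xm] /andP[y0 ym] xy.
have [a0|a0|a0] := ltgtP a 0; [nia|nia|].
by rewrite xy a0 mul0r addr0.
Qed.

(* Steps (1, 2) through the even row, a step (2, 1), steps (-1, -2) through the
   odd row, and a closing step (-2, 1). *)
Definition walk_even (m i : nat) : int * int :=
  if (i < m)%N then (i%:Z, 2 * i%:Z)
  else if (i < m.*2)%N then (m.*2.+1%:Z - i%:Z, m.*2.*2%:Z - 1 - 2 * i%:Z)
  else (0, 2).

Lemma knightbP (d : int * int) :
  reflect (`|d.1|%N = 1%N /\ `|d.2|%N = 2%N \/ `|d.1|%N = 2%N /\ `|d.2|%N = 1%N)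
    (knightb d).
Proof.
rewrite /knightb /=; move: `|d.1|%N `|d.2|%N => a b.
by case: a => [|[|[|a]]]; case: b => [|[|[|b]]]; rewrite /perm_eq /= ?eqxx ?eqSS;
  apply: (iffP idP) => //; lia.
Qed.

(** The parity of the row separates the two halves of the walk; within one half the column tells the
    positions apart. *)
Lemma walk_evenP m : (0 < m)%N -> longitude_walk m 2 (walk_even m).
Proof.
move=> m0; split.
- by rewrite /walk_even m0.
- by rewrite /walk_even muln2 !ifN //; lia.
- move=> i; rewrite muln2 => iN; apply/knightbP; rewrite /walk_even.
  by do ![case: ifP => ?] => /=; lia.
move=> i j a b; rewrite muln2 /walk_even => iN jN.
rewrite iN jN; have [im|im] := ltnP i m; have [jm|jm] := ltnP j m => /= h1 h2.
- by clear h2; have := eq_of_congr _ _ h1; lia.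
- by clear h1; lia.
- by clear h1; lia.
(* The columns 2 m + 1 - i of the second half are lowered by 2, which brings them into the range [0,
   m). *)
clear h2; have {}h1 : m.*2%:Z - 1 - i%:Z = (m.*2%:Z - 1 - j%:Z) + a * m%:Z.
  by lia.
by have := eq_of_congr _ _ h1; lia.
Qed.

(* On T_{m x 1} with m = 2 h + 1: up the even columns, back down the odd ones. *)
Definition walk_odd (h i : nat) : int * int :=
  if (i <= h)%N then (2 * i%:Z, i%:Z)
  else if (i <= h.*2)%N then (h.*2.*2%:Z + 1 - 2 * i%:Z, h.*2%:Z - 1 - i%:Z)
  else (0, 1).

(** The columns already lie in [0, m) and are pairwise distinct, so they alone separate the
    positions. *)
Lemma walk_oddP h : (0 < h)%N -> longitude_walk h.*2.+1 1 (walk_odd h).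
Proof.
move=> h0; split.
- by [].
- by rewrite /walk_odd muln1 !ifN //; lia.
- move=> i; rewrite muln1 => iN; apply/knightbP; rewrite /walk_odd.
  by do ![case: ifP => ?] => /=; lia.
move=> i j a b; rewrite muln1 /walk_odd => iN jN + _.
rewrite !ltnS in iN jN; rewrite iN jN.
by case: ifP => ?; case: ifP => ? /= /eq_of_congr; lia.
Qed.

(* On T_{1 x n} with n odd: the rows 0, 2, 1, 3, 4, ..., n - 1. *)
Definition walk_column (i : nat) : int * int :=
  match i with
  | 0 => (0, 0) | 1 => (1, 2) | 2 => (-1, 1)
  | _ => (if odd i then 0 else 2, i%:Z)
  end.

(** With a single column the horizontal coordinate serves only to make each step a knight step. It
    alternates between 0 and 2 from index 3 on, and ends at 0 because n is odd. *)
Lemma walk_columnP n : odd n -> (2 < n)%N -> longitude_walk 1 n walk_column.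
Proof.
move=> on n2; split; rewrite ?mul1n //.
- by case: n on n2 => [|[|[|n]]] //= ->.
- move=> [|[|[|i]]] // _; apply/knightbP => /=.
  by rewrite !negbK; case: (odd i) => /=; lia.
pose y i := (walk_column i).2.
have yE i : (i = 0 /\ y i = 0 \/ i = 1 /\ y i = 2 \/ i = 2 /\ y i = 1 \/
             (2 < i)%N /\ y i = i%:Z)%N.
  by case: i => [|[|[|i]]]; rewrite /y /=; lia.
move=> i j a b iN jN _; rewrite -/(y i) -/(y j) => /eq_of_congr.
by have := yE i; have := yE j; lia.
Qed.

Lemma longitude_walk_repeat m n d P : (0 < m)%N -> (0 < n)%N ->
  longitude_walk m n P ->
  longitude_walk m (n * d)
    (fun i => P (i %% (m * n))%N + (0, (n * (i %/ (m * n)))%:Z)).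
Proof.
move=> m0 n0 [P0 PN Pk Pinj]; have N0 : (0 < m * n)%N by rewrite muln_gt0 m0.
split.
- by rewrite mod0n div0n P0 muln0 addr0.
- by rewrite mulnA modnMr mulKn // P0 add0r.
- move=> i; rewrite mulnA => iN.
  (* The remainder wraps to 0 only at the end of a round. The step there is the last one of [P], as
     [P] ends at (0, n), where the next round starts. *)
  rewrite modnS divnS //; case: ifP => /= dvd; last first.
    by rewrite add0n opprD addrACA subrr addr0 Pk ?ltn_mod.
  have iE : (i %% (m * n)).+1 = (m * n)%N.
    apply/eqP; rewrite eqn_leq ltn_pmod //= dvdn_leq //.
    by rewrite /dvdn -addn1 modnDml addn1.
  rewrite P0; have := Pk _ (ltn_pmod i N0); rewrite iE PN.
  congr (is_true (knightb _)).
  rewrite [P _]surjective_pairing; congr pair => /=; lia.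
move=> i j a b iN jN /= h1 h2.
have ij : (i %% (m * n) = j %% (m * n))%N.
  (* A congruence modulo n d is also one modulo n, and the rounds contribute multiples of n. Equal
     remainders then leave a congruence modulo d between the round numbers, which are below d. *)
  apply: (Pinj _ _ a (b * d%:Z + (j %/ (m * n))%:Z - (i %/ (m * n))%:Z));
    by rewrite ?ltn_mod //; lia.
rewrite (divn_eq i (m * n)) (divn_eq j (m * n)) ij.
suff -> : (i %/ (m * n) = j %/ (m * n))%N by [].
have : (i %/ (m * n))%:Z = (j %/ (m * n))%:Z + b * d%:Z.
  rewrite ij in h2; nia.
have lt k : (k < m * (n * d))%N -> (k %/ (m * n) < d)%N.
  by move=> kN; rewrite ltn_divLR // mulnC -mulnA.
move: (lt i iN) (lt j jN); move: (i %/ _)%N (j %/ _)%N => k l kd ld /eq_of_congr E.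
by apply/eqP; rewrite -eqz_nat E ?lez_nat ?ltz_nat.
Qed.

(** * Lifts of tours *)

Section lift.
Context {R : realType}.
Implicit Types (p : R * R) (d : int * int).

Definition plane d : R * R := (d.1%:~R, d.2%:~R).

Lemma planeD d d' : plane (d + d') = plane d + plane d'.
Proof. by rewrite /plane /= !intrD. Qed.

Lemma path_concat_continuous (f g : R -> R * R) :
  continuous f -> continuous g -> f 1 = g 0 -> continuous (path_concat f g).
Proof.
move=> cf cg fg.
(* This form of the concatenation is a composition of continuous functions. *)
have -> : path_concat f g = fun s =>
    f (((fun s => 2 * s) \min cst 1) s) +
    (g (((fun s => 2 * s - 1) \max cst 0) s) - g 0).
  apply/funext => s; rewrite /path_concat /=.
  case: ifP => h.
    by rewrite min_l ?max_r ?subrr ?addr0 //; lra.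
  rewrite min_r ?max_l; [|lra|lra].
  by rewrite /= fg addrCA subrr addr0.
have c2 : continuous (fun s : R => 2 * s) by move=> s; apply: cvgMr; exact: cvg_id.
move=> s; apply: cvgD; last apply: cvgB; last exact: cvg_cst.
- apply: (continuous_comp _ (cf _)).
  by apply: continuous_min; [exact: c2 | exact: cvg_cst].
- apply: (continuous_comp _ (cg _)).
  apply: continuous_max; last exact: cvg_cst.
  by apply: cvgB; [exact: c2 | exact: cvg_cst].
Qed.

Lemma affine_continuous p q : continuous (fun s : R => p + s *: q).
Proof.
move=> s; apply: cvgD; first exact: cvg_cst.
by apply: cvgZ; [exact: cvg_id | exact: cvg_cst].
Qed.

Fixpoint polyline p (ks : seq (int * int)) : R -> R * R :=
  if ks is k :: ks' then
    path_concat (fun s => p + s *: plane k) (polyline (p + plane k) ks')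
  else cst p.

Lemma polyline0 p ks : polyline p ks 0 = p.
Proof.
case: ks => [//|k ks] /=.
by rewrite /path_concat invr_ge0 ler0n mulr0 scale0r addr0.
Qed.

Lemma polyline1 p ks : polyline p ks 1 = p + plane (\sum_(k <- ks) k).
Proof.
elim: ks p => [|k ks IH] p /=; first by rewrite big_nil addr0.
rewrite /path_concat ifN; last by rewrite -ltNge; lra.
by rewrite mulr1 (_ : 2 - 1 = 1) ?IH ?big_cons ?planeD ?addrA //; lra.
Qed.

Lemma polyline_continuous p ks : continuous (polyline p ks).
Proof.
elim: ks p => [|k ks IH] p /=; first exact: cst_continuous.
apply: path_concat_continuous; [|exact: IH|by rewrite polyline0 scale1r].
exact: affine_continuous.
Qed.

End lift.

Section tour_lift.
Context (R : realType) (m n : nat).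
Local Notation T := (torus R m n).
Implicit Types (J : jump m n) (u w : vertex m n) (p : R * R).

Definition center u : R * R := (u.1%:R + 2^-1, u.2%:R + 2^-1).

Lemma ord_shiftE (l : nat) (a : 'I_l) (x : int) :
  ord_shift a x = a%:Z + x - ((a%:Z + x) %/ l%:Z)%Z * l%:Z :> int.
Proof.
have l0 : l%:Z != 0 by case: l a => [[]|].
by rewrite /= gez0_abs ?modz_ge0.
Qed.

Lemma center_head J :
  \pi_T (center (jump_head J)) = \pi_T (center J.2 + plane (val J.1)).
Proof.
case: J => d [a b]; apply/torus_piP.
(* The quotients discarded by the reduction modulo m and n give the lattice vector. *)
exists (((a%:Z + (val d).1) %/ m%:Z)%Z, ((b%:Z + (val d).2) %/ n%:Z)%Z).
have E (l : nat) (c : 'I_l) (x : int) : c%:R + 2^-1 + x%:~R - ((ord_shift c x)%:R + 2^-1)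
    = ((c%:Z + x) %/ l%:Z)%Z%:~R * l%:R :> R.
  rewrite -[(ord_shift c x)%:R]/((ord_shift c x : int)%:~R) ord_shiftE.
  by rewrite intrD intrN intrM intrD -!pmulrn; ring.
by rewrite -!E.
Qed.

Fixpoint chain u (s : seq (jump m n)) w : Prop :=
  if s is J :: s' then J.2 = u /\ chain (jump_head J) s' w else u = w.

(** The induction needs an arbitrary p above the center of u: the polyline moves on in the plane,
    while the vertices are reduced after each jump. *)
Lemma traverse_polyline u s w p x :
  chain u s w -> \pi_T p = \pi_T (center u) ->
  \pi_T (center w) = torus_base R :> T ->
  traverse (torus_base R : T) [seq jump_path (R := R) J | J <- s] x =
    \pi_T (polyline p [seq val J.1 | J <- s] x).
Proof.
move=> + + wE; elim: s u p x => [|J s IH] u p x /=; first by move=> -> ->.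
move=> [<- /IH {}IH] pu; rewrite /path_concat; case: ifP => _.
  have /torus_piP[d dE] := pu; apply/torus_piP.
  exists (- d.1, - d.2); rewrite /= !mulrNz !mulNr.
  have [-> ->] : (d.1%:~R * m%:R = (J.2.1%:R + 2^-1 - p.1) /\
    d.2%:~R * n%:R = (J.2.2%:R + 2^-1 - p.2)) by case: dE.
  by congr pair => /=; rewrite -/(GRing.scale _ _) /GRing.scale /=; ring.
apply: IH; rewrite center_head; have /torus_piP[d dE] := pu.
by apply/torus_piP; exists d; rewrite -dE opprD addrACA subrr addr0.
Qed.

Section cyclic_chain.
Context (N : nat) (N0 : (0 < N)%N).
Context (v : 'I_N -> vertex m n) (J : 'I_N -> jump m n).
Hypotheses (Jtail : forall i, (J i).2 = v i).
Hypotheses (Jhead : forall i, jump_head (J i) = v (ordS i)).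

Let o k : 'I_N := Ordinal (ltn_pmod k N0).

Lemma chain_enum : chain (v (o 0)) [seq J i | i <- enum 'I_N] (v (o 0)).
Proof.
have -> : enum 'I_N = [seq o k | k <- iota 0 N].
  apply: (inj_map val_inj); rewrite val_enum_ord -map_comp -[LHS]map_id.
  by apply/eq_in_map => k; rewrite mem_iota /= add0n => /modn_small ->.
have oN : o 0 = o (0 + N) by apply: val_inj; rewrite /= add0n modnn mod0n.
(* The induction on the length b needs an arbitrary start a; the chain closes up because
   [o N = o 0]. *)
suff gen b a : chain (v (o a)) [seq J i | i <- [seq o k | k <- iota a b]] (v (o (a + b))).
  by rewrite {2}oN.
elim: b a => [|b IH] a /=; first by rewrite addn0.
rewrite Jtail Jhead addnS -addSn; split=> //.
by have -> : ordS (o a) = o a.+1 by apply: val_inj; rewrite /= -addn1 modnDml addn1.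
Qed.

Lemma lifts_traverse :
  (forall i : 'I_N, i = 0%N :> nat -> (v i).1 = 0%N :> nat /\ (v i).2 = 0%N :> nat) ->
  lifts (polyline (2^-1, 2^-1) [seq val (J i).1 | i <- enum 'I_N])
    (traverse (torus_base R : T) [seq jump_path (R := R) (J i) | i <- enum 'I_N]).
Proof.
move=> v0; split=> [|s _].
  by apply: continuous_subspaceT; exact: polyline_continuous.
have [h1 h2] := v0 (o 0) (mod0n _).
have c0 : center (v (o 0)) = (2^-1, 2^-1) by rewrite /center h1 h2 !add0r.
rewrite (map_comp (@jump_path R m n) J) (map_comp (fun K : jump m n => val K.1) J).
by rewrite (traverse_polyline _ chain_enum (p := (2^-1, 2^-1))) // c0.
Qed.

End cyclic_chain.

Lemma lifts_longitude :
  lifts (fun s => (2^-1, 2^-1) + s *: plane (0, n%:Z)) (@longitude R m n).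
Proof.
split=> [|s _]; first by apply: continuous_subspaceT; exact: affine_continuous.
by apply/torus_piP; exists (0, 0); congr pair; rewrite /= /GRing.scale /= -pmulrn; ring.
Qed.

Lemma lifts_longitude_reverse :
  lifts (fun s => (2^-1, 2^-1) + s *: plane (0, - n%:Z))
    (path_reverse (@longitude R m n)).
Proof.
split=> [|s _]; first by apply: continuous_subspaceT; exact: affine_continuous.
(* The formula for the reverse starts at (1/2, 1/2 + n), one vertical period above the start of the
   lift. *)
apply/torus_piP; exists (0, 1); congr pair.
  by rewrite /= /GRing.scale /=; ring.
by rewrite /= /GRing.scale /= intrN -pmulrn; ring.
Qed.

(** The class of J consists of J and its reverse; the reverse starts at the head of J, so when J is
    not a loop only J starts at its tail. *)
Lemma orient_pi J : jump_head J != J.2 -> orient J.2 (\pi_(edge m n) J) = J.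
Proof.
move=> hJ; rewrite /orient.
have /eqmodP : J = repr (\pi_(edge m n) J) %[mod edge m n] by rewrite reprK.
rewrite /= /jump_rel => /orP[] /eqP <-; first by rewrite eqxx.
by rewrite /jump_tail /= (negPf hJ) jump_revK.
Qed.

End tour_lift.

Lemma val_ordS_eq N (i : 'I_N) : (1 < N)%N -> ordS i != i.
Proof.
move=> N1; apply/eqP => /(congr1 val) /=.
have [iN|iN] := ltnP i.+1 N; first by rewrite modn_small //; lia.
have -> : i.+1 = N by apply/eqP; rewrite eqn_leq iN ltn_ord.
by rewrite modnn; lia.
Qed.

(** Successive vertices of a tour differ when m n > 1, so its edges are not loops and [orient]
    recovers the jumps. *)
Lemma orient_tour m n (v : 'I_(m * n) -> vertex m n) e (i : 'I_(m * n)) :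
  is_tour v e -> (m * n)%N != 1%N ->
  (orient (v i) (e i)).2 = v i /\ jump_head (orient (v i) (e i)) = v (ordS i).
Proof.
move=> [/bij_inj vinj _ vE] /eqP mn1; have [_ /(_ i)[J [<- Jt Jh]]] := vE mn1.
have vi : v (ordS i) != v i.
  by rewrite (inj_eq vinj) val_ordS_eq //; have := ltn_ord i; lia.
by rewrite -Jt orient_pi // Jh [J.2]Jt.
Qed.

(** * The parity obstruction *)

Lemma knight_sum_parity (ks : seq (int * int)) : all knightb ks ->
  exists c : int, (\sum_(k <- ks) k).1 + (\sum_(k <- ks) k).2 = (size ks)%:Z + 2 * c.
Proof.
elim: ks => [|k ks IH] /=; first by exists 0; rewrite big_nil.
move=> /andP[/knightbP kk /IH[c cE]]; rewrite big_cons /=.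
have [c' c'E] : exists c' : int, k.1 + k.2 = 1 + 2 * c'.
  by exists ((k.1 + k.2) %/ 2)%Z; lia.
exists (c + c'); rewrite addrACA c'E cE mulrDr addrACA -PoszD add1n.
by rewrite [2 * c' + _]addrC.
Qed.

Lemma longitude_tour_parity (R : realType) m n : (0 < m)%N -> (0 < n)%N ->
  (m * n)%N != 1%N -> supports_longitude_tour R m n -> odd m \/ ~~ odd n.
Proof.
move=> m0 n0 mn1 [v [e [te re]]].
pose J i := orient (v i) (e i).
have Jt i : (J i).2 = v i by case: (orient_tour i te mn1).
have Jh i : jump_head (J i) = v (ordS i) by case: (orient_tour i te mn1).
have N0 : (0 < m * n)%N by rewrite muln_gt0 m0.
have v0 : forall i : 'I_(m * n), i = 0%N :> nat ->
  (v i).1 = 0%N :> nat /\ (v i).2 = 0%N :> nat by case: te.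
have lT := lifts_traverse R N0 Jt Jh v0.
have tourE : tour_loop v e = traverse (torus_base R : torus R m n)
  [seq jump_path (R := R) (J i) | i <- enum 'I_(m * n)].
  by rewrite /tour_loop (negPf mn1).
set ks := [seq val (J i).1 | i <- enum 'I_(m * n)] in lT.
have kks : all knightb ks by apply/allP => _ /mapP[i _ ->]; exact: valP.
have [c cE] := knight_sum_parity kks.
rewrite size_map size_enum_ord in cE.
(* Common end of both cases: the endpoint of the lift determines the sum of the steps, whose
   coordinate sum has the parity of m n and equals n or -n. *)
have fin (z : int) : z = n%:Z \/ z = - n%:Z ->
    (2^-1, 2^-1) + plane (\sum_(k <- ks) k) = (2^-1, 2^-1) + plane (0, z) :> R * R ->
    odd m \/ ~~ odd n.
  move=> zn /addrI[/intr_inj s1 /intr_inj s2].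
  have : odd (m * n) = odd n.
    rewrite s1 s2 add0r in cE.
    by clear - zn cE; case: zn => zn; rewrite zn in cE; lia.
  by rewrite oddM; case: (odd n); case: (odd m) => // _; [left|right|right].
case: re; rewrite tourE => hom.
  have := loop_homotopic_lifts m0 n0 lT (lifts_longitude R m n) hom.
  by rewrite polyline0 polyline1 scale0r scale1r addr0 => /(_ erefl); apply: fin; left.
have := loop_homotopic_lifts m0 n0 lT (lifts_longitude_reverse R m n) hom.
by rewrite polyline0 polyline1 scale0r scale1r addr0 => /(_ erefl); apply: fin; right.
Qed.

(** * From walks to tours *)

Section tour_of_walk.
Context (m n : nat) (m0 : (0 < m)%N) (n0 : (0 < n)%N).
Implicit Types p q : int * int.

Definition residue p : vertex m n :=
  (ord_shift (Ordinal m0) p.1, ord_shift (Ordinal n0) p.2).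

Lemma ord_shiftD l (a : 'I_l) x y : ord_shift (ord_shift a x) y = ord_shift a (x + y).
Proof.
have l0 : l%:Z != 0 by case: l a => [[]|].
by apply: val_inj => /=; rewrite gez0_abs ?modz_ge0 // modzDml addrA.
Qed.

Lemma jump_head_residue (k : knight) p :
  jump_head (k, residue p) = residue (p + val k).
Proof. by rewrite /jump_head /residue /= !ord_shiftD. Qed.

Lemma ord_shift_congr l (l0 : (0 < l)%N) x y :
  ord_shift (Ordinal l0) x = ord_shift (Ordinal l0) y ->
  exists a, x = y + a * l%:Z.
Proof.
move=> /(congr1 (fun i : 'I_l => (i : nat)%:Z)); rewrite !ord_shiftE !add0r => E.
by exists ((x %/ l)%Z - (y %/ l)%Z); rewrite mulrBl; lia.
Qed.

Lemma residue_congr p q : residue p = residue q ->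
  exists a b, p.1 = q.1 + a * m%:Z /\ p.2 = q.2 + b * n%:Z.
Proof.
move=> E; have [a aE] := ord_shift_congr (congr1 fst E).
by have [b bE] := ord_shift_congr (congr1 snd E); exists a, b.
Qed.

Lemma residue_full_turn : residue (0, n%:Z) = residue (0, 0).
Proof.
by congr pair; apply: val_inj; rewrite //= !add0r modzz mod0z.
Qed.

Lemma walk_supports (R : realType) P : (m * n)%N != 1%N ->
  longitude_walk m n P -> supports_longitude_tour R m n.
Proof.
move=> mn1 [P0 PN Pk Pinj].
pose k (i : 'I_(m * n)) : knight := exist knightb _ (Pk i (ltn_ord i)).
pose v (i : 'I_(m * n)) := residue (P i).
pose J i : jump m n := (k i, v i); pose e i := \pi_(edge m n) (J i).
have N0 : (0 < m * n)%N by rewrite muln_gt0 m0.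
have N1 : (1 < m * n)%N by lia.
have vinj : injective v.
  move=> i j /residue_congr[a [b [h1 h2]]]; apply: val_inj.
  exact: Pinj h1 h2.
have Jh i : jump_head (J i) = v (ordS i).
  rewrite jump_head_residue /= addrCA subrr addr0 /v /=.
  have [iN|iN] := ltnP i.+1 (m * n); first by rewrite modn_small.
  (* The last step leads to (0, n), which reduces to the starting vertex. *)
  have -> : i.+1 = (m * n)%N by apply/eqP; rewrite eqn_leq iN ltn_ord.
  by rewrite modnn P0 PN residue_full_turn.
have einj : injective e.
  move=> i j /eqmodP; rewrite /= /jump_rel => /orP[/eqP/(congr1 snd)/vinj//|/eqP h].
  (* Two steps can share an edge only when m n = 2, and then they cancel,
     whereas the total displacement (0, n) is not zero. *)
  exfalso.
  have vj : v (ordS i) = v j by rewrite -Jh -[RHS]/(J j).2 -h.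
  have vi : v (ordS j) = v i by rewrite -Jh -h -[RHS]/(J i).2 -{2}[J i]jump_revK.
  have kk : (P i.+1 - P i) + (P j.+1 - P j) = 0.
    have <- : val (knight_opp (k i)) = P j.+1 - P j by rewrite -[RHS]/(val (J j).1) -h.
    by rewrite /= -[(- _, - _)]/(- (P i.+1 - P i)) subrr.
  have ij := vinj _ _ vj; have ji := vinj _ _ vi.
  move/(congr1 val): ij; move/(congr1 val): ji => /= ji ij.
  have [iN jN] := (ltn_ord i, ltn_ord j).
  have : (i = 0%N :> nat /\ j = 1%N :> nat \/ i = 1%N :> nat /\ j = 0%N :> nat) /\
      (m * n = 2)%N.
    have S l : (l < m * n)%N -> (l.+1 %% (m * n) = if l.+1 == m * n then 0 else l.+1)%N.
      move=> lN; case: eqP => [->|?]; first by rewrite modnn.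
      by rewrite modn_small //; lia.
    rewrite !S // in ij ji; move: ij ji; case: eqP; case: eqP; lia.
  move=> [ij01 N2]; move: PN; rewrite N2 => PN.
  have : P 2%N - P 0%N = 0.
    have -> : P 2%N - P 0%N = (P 2%N - P 1%N) + (P 1%N - P 0%N) by rewrite addrA subrK.
    by case: ij01 => -[i0 j0]; move: kk; rewrite i0 j0 // addrC.
  by rewrite P0 PN => -[]; lia.
have tail0 (i : 'I_(m * n)) : i = 0%N :> nat ->
    (v i).1 = 0%N :> nat /\ (v i).2 = 0%N :> nat.
  by move=> i0; rewrite /v i0 P0 /= !addr0 !mod0z.
exists v, e; split.
  split=> //; first by apply: inj_card_bij => //; rewrite card_prod !card_ord.
  by move=> _; split=> // i; exists (J i).
left; rewrite /tour_loop (negPf mn1).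
have -> : [seq jump_path (R := R) (orient (v i) (e i)) | i <- enum 'I_(m * n)] =
          [seq jump_path (R := R) (J i) | i <- enum 'I_(m * n)].
  apply: eq_map => i; rewrite -[v i]/(J i).2 orient_pi //.
  by rewrite Jh (inj_eq vinj) val_ordS_eq.
have lT := lifts_traverse R N0 (J := J) (fun=> erefl) Jh tail0.
have sumE : \sum_(d <- [seq val (J i).1 | i <- enum 'I_(m * n)]) d = (0, n%:Z).
  (* The steps telescope to the difference between the last and the first position. *)
  rewrite big_map big_enum /= -(big_mkord xpredT (fun i => P i.+1 - P i)).
  by rewrite telescope_sumr // P0 PN subr0.
apply: (straight_line_homotopic lT (lifts_longitude R m n)).
- by rewrite polyline0.
- rewrite polyline1 sumE; apply/torus_piP; exists (0, -1).
  by congr pair; rewrite /= -?pmulrn; ring.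
- by rewrite polyline0 scale0r addr0.
- by rewrite polyline1 sumE scale1r.
Qed.

End tour_of_walk.

(** * Existence of walks and the equivalence *)

Lemma longitude_walk_exists m n : (0 < m)%N -> (0 < n)%N -> (m * n)%N != 1%N ->
  odd m \/ ~~ odd n -> exists P, longitude_walk m n P.
Proof.
move=> m0 n0 mn1 mn; have [on|en] := boolP (odd n); last first.
  rewrite -(even_halfK en) -mul2n; eexists.
  by apply: longitude_walk_repeat => //; exact: walk_evenP.
have om : odd m by case: mn => //; rewrite on.
have [m1|m1] := eqVneq m 1%N.
  (* Here n is odd and different from 1, hence at least 3. *)
  rewrite m1 in mn1 *; exists walk_column; apply: walk_columnP => //.
  by lia.
rewrite -[n]mul1n -[m]odd_double_half om add1n; eexists.
by apply: longitude_walk_repeat => //; apply: walk_oddP; lia.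
Qed.

Theorem theorem6p1 (R : realType) (m n : nat) (hm : (0 < m)%N) (hn : (0 < n)%N)
    (hmn : ~ (m = 1%N /\ n = 1%N)) :
  supports_longitude_tour R m n <-> odd m \/ ~~ odd n.
Proof.
have mn1 : (m * n)%N != 1%N.
  by rewrite muln_eq1; apply/andP => -[/eqP m1 /eqP n1]; apply: hmn.
split; first exact: longitude_tour_parity.
move=> /(longitude_walk_exists hm hn mn1)[P PP].
exact: (walk_supports hm hn R mn1 PP).
Qed.
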